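(* Let $G:\mathbb{N}\to\mathrm{Grp}$ be a tower of groups. Denote by $G_\omega=\lim_{n\in\mathbb{N}}G_n$ its limit and, for every $n\in\mathbb{N}$, by $\phi_n:G_\omega\to G_n$ the natural map. Suppose that $F\triangleleft G_\omega$ is a normal subgroup such that the quotient $G_\omega/F$ is abelian and for every $n\in\mathbb{N}$ we have $$\phi_n(F)=\phi_n(G_\omega).$$ Then the abelian group $G_\omega/F$ is cotorsion.
   Context: $\mathbb{N}=\{0,1,2,\dots\}$. A tower of groups $G:\mathbb{N}\to\mathrm{Grp}$ consists of groups $G_n$ ($n\in\mathbb{N}$) and arbitrary homomorphisms $g_{n+1}:G_{n+1}\to G_n$; its limit is the subgroup $\{(x_n)\in\prod_n G_n : g_{n+1}(x_{n+1})=x_n \text{ for all } n\}$ of the product, and $\phi_n$ is the restriction of the $n$-th projection. An abelian group $A$ is cotorsion if $\mathrm{Ext}(\mathbb{Q},A)=0$, i.e. for every abelian group $B$ containing $A$ as a subgroup with $B/A\cong\mathbb{Q}$, $A$ is a direct summand of $B$. *)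

(* Defs.v *)
(* By the classical axioms of boolp every type is a [choiceType] and every subset
   a boolean predicate, so [groupType], [zmodType], [groupClosed] and
   [zmodClosed] cover arbitrary groups, abelian groups and their subgroups. *)
From HB Require Import structures.
From mathcomp Require Import all_boot ssralg rat ring_quotient.
From mathcomp Require Import boolp classical_sets.

Set Implicit Arguments.
Unset Strict Implicit.
Unset Printing Implicit Defensive.

Local Open Scope group_scope.

Section ProductGroup.
Variables (I : Type) (G : I -> groupType).
Implicit Types x y z : forall i, G i.

Definition prodg_one : forall i, G i := fun=> 1.
Definition prodg_inv x : forall i, G i := fun i => (x i)^-1.
Definition prodg_mul x y : forall i, G i := fun i => x i * y i.

Lemma prodg_mulA : associative prodg_mul.
Proof. by move=> x y z; apply: functional_extensionality_dep => i; exact: mulgA. Qed.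
Lemma prodg_mul1 : left_id prodg_one prodg_mul.
Proof. by move=> x; apply: functional_extensionality_dep => i; exact: mul1g. Qed.
Lemma prodg_mulr1 : right_id prodg_one prodg_mul.
Proof. by move=> x; apply: functional_extensionality_dep => i; exact: mulg1. Qed.
Lemma prodg_mulV : left_inverse prodg_one prodg_inv prodg_mul.
Proof. by move=> x; apply: functional_extensionality_dep => i; exact: mulVg. Qed.
Lemma prodg_mulrV : right_inverse prodg_one prodg_inv prodg_mul.
Proof. by move=> x; apply: functional_extensionality_dep => i; exact: mulgV. Qed.

HB.instance Definition _ := isGroup.Build (forall i, G i)
  prodg_mulA prodg_mul1 prodg_mulr1 prodg_mulV prodg_mulrV.

End ProductGroup.

(* [bond n] is the map written g_(n+1) on paper. *)
Record tower := Tower {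
  tower_obj :> nat -> groupType;
  bond : forall n, {multiplicative tower_obj n.+1 -> tower_obj n} }.

Section Limit.
Variable G : tower.

Definition compatible : {pred forall n, G n} :=
  [pred x | `[< forall n, bond G n (x n.+1) = x n >]].

Lemma compatible_group_closed : group_closed compatible.
Proof.
have bond1 n : bond G n 1 = 1.
  by apply: (mulgI (bond G n 1)); rewrite -gmulfM !mulg1.
split=> [|x y /asboolP xP /asboolP yP]; apply/asboolP => n; first exact: bond1.
have bondV : bond G n (y n.+1)^-1 = (bond G n (y n.+1))^-1.
  by apply: (mulgI (bond G n (y n.+1))); rewrite -gmulfM !mulgV bond1.
by rewrite gmulfM bondV xP yP.
Qed.

Definition limit_group := {x : forall n, G n | x \in compatible}.
HB.instance Definition _ := SubChoice.on limit_group.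
HB.instance Definition _ :=
  SubChoice_isSubGroup.Build _ _ limit_group compatible_group_closed.

Definition lim_proj (n : nat) (x : limit_group) : G n := val x n.

Lemma lim_proj_mul n : {morph lim_proj n : x y / x * y}.
Proof. by move=> x y; rewrite /lim_proj valM. Qed.
HB.instance Definition _ n :=
  isMultiplicative.Build limit_group (G n) (lim_proj n) (lim_proj_mul n).

End Limit.

HB.mixin Record isConjClosed (G : groupType) (S : {pred G}) := {
  gpredJr : {in S, forall x y, x ^ y \in S}
}.

#[short(type="normalClosed")]
HB.structure Definition NormalClosed (G : groupType) :=
  {S of GroupClosed G S & isConjClosed G S}.

Section QuotientGroup.
Local Open Scope quotient_scope.
Variables (G : groupType) (F : normalClosed G).

Definition eqv_mod (x y : G) := x / y \in F.

Lemma eqv_mod_is_equiv : equiv_class_of eqv_mod.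
Proof.
split=> [x|x y|y x z]; rewrite /eqv_mod ?mulgV ?gpred1 //.
  by rewrite gpredFC.
by move=> xy yz; rewrite -(divgKA y) gpredM.
Qed.

Canonical eqv_mod_equiv := EquivRelPack eqv_mod_is_equiv.
Canonical eqv_mod_encModRel := defaultEncModRel eqv_mod.

Definition quotg := {eq_quot eqv_mod}.
HB.instance Definition _ : EqQuotient G eqv_mod quotg := EqQuotient.on quotg.
HB.instance Definition _ := Choice.on quotg.

Lemma eqv_modE x y : (x / y \in F) = (x == y %[mod quotg]).
Proof. by rewrite piE. Qed.

Definition quotg_one : quotg := lift_cst quotg 1.
Definition quotg_mul := lift_op2 quotg *%g.
Definition quotg_inv := lift_op1 quotg (fun x => x^-1).

Canonical pi_quotg_one := PiConst quotg_one.

Lemma pi_inv : {morph \pi : x / x^-1 >-> quotg_inv x}.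
Proof.
move=> x; unlock quotg_inv; apply/eqP; rewrite -eqv_modE invgK.
have : repr (\pi_quotg x) / x \in F by rewrite eqv_modE reprK.
by move=> /gpredJr /(_ x); rewrite /conjg mulgVK.
Qed.
Canonical pi_quotg_inv := PiMorph1 pi_inv.

Lemma pi_mul : {morph \pi : x y / x * y >-> quotg_mul x y}.
Proof.
move=> x y; unlock quotg_mul; apply/eqP; rewrite -eqv_modE.
set x' := repr _; set y' := repr _.
have xF : x / x' \in F by rewrite eqv_modE reprK.
have yF : y / y' \in F by rewrite eqv_modE reprK.
have -> : x * y / (x' * y') = (x / x') * (y / y') ^ x'^-1.
  by rewrite /conjg invgK invgM !mulgA mulgVK.
by rewrite gpredM ?gpredJr.
Qed.
Canonical pi_quotg_mul := PiMorph2 pi_mul.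

Lemma quotg_mulA : associative quotg_mul.
Proof. by move=> x y z; rewrite -[x]reprK -[y]reprK -[z]reprK !piE mulgA. Qed.
Lemma quotg_mul1 : left_id quotg_one quotg_mul.
Proof. by move=> x; rewrite -[x]reprK !piE mul1g. Qed.
Lemma quotg_mulr1 : right_id quotg_one quotg_mul.
Proof. by move=> x; rewrite -[x]reprK !piE mulg1. Qed.
Lemma quotg_mulV : left_inverse quotg_one quotg_inv quotg_mul.
Proof. by move=> x; rewrite -[x]reprK !piE mulVg. Qed.
Lemma quotg_mulrV : right_inverse quotg_one quotg_inv quotg_mul.
Proof. by move=> x; rewrite -[x]reprK !piE mulgV. Qed.

HB.instance Definition _ := isGroup.Build quotg
  quotg_mulA quotg_mul1 quotg_mulr1 quotg_mulV quotg_mulrV.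

HB.instance Definition _ := isMultiplicative.Build G quotg \pi_quotg pi_mul.

End QuotientGroup.

Section AdditiveGroup.
Variables (A : groupType) (abelA : forall x y : A, x * y = y * x).

(* The commutative group [A], written additively. *)
Definition additive_group : Type := let _ := abelA in A.
HB.instance Definition _ := Choice.copy additive_group A.
HB.instance Definition _ := GRing.isZmodule.Build additive_group
  (@mulgA A) abelA (@mul1g A) (@mulVg A).

End AdditiveGroup.

Section Cotorsion.
Local Open Scope ring_scope.

Definition isomorphic (U V : zmodType) : Prop :=
  exists f : {additive U -> V}, bijective f.

Definition direct_summand (B : zmodType) (S : zmodClosed B) : Prop :=
  exists C : zmodClosed B,
    (forall b, b \in S -> b \in C -> b = 0) /\
    (forall b, exists s c, [/\ s \in S, c \in C & b = s + c]).

(* A group containing [A] as a subgroup is an injective morphism [i] out of [A];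
   [S] is its image. *)
Definition cotorsion (A : zmodType) : Prop :=
  forall (B : zmodType) (i : {additive A -> B}) (S : zmodClosed B),
    injective i -> (forall b, b \in S <-> exists a, b = i a) ->
    isomorphic (Quotient.quot S) rat -> direct_summand S.

End Cotorsion.

(* Main.v *)
(* An abelian group [A] is cotorsion as soon as each system
   [x_n = a_n + (n+1) x_(n+1)] is solvable in [A]: elements [b_n] lifting
   [1/n!] can then be corrected by elements of [A] so as to satisfy
   [b_n = (n+1) b_(n+1)], and their multiples form a complement of [A].
   For [A = G_omega/F] one lifts [a_n] to some [h_n] killed by [phi_n], which
   exists since [phi_n F = phi_n G_omega].  The non-abelian system
   [x_n = h_n x_(n+1)^(n+1)] is then solvable in [G_omega], because in the
   coordinate [k] all [h_n] with [n >= k] vanish and the infinite iteration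
   [h_n (h_(n+1) (...)^(n+2))^(n+1)] becomes finite. *)
Require Import Defs.
From HB Require Import structures.
From mathcomp Require Import all_boot ssralg ssrnum ssrint rat ring_quotient.
From mathcomp Require Import boolp classical_sets.

Import GRing.Theory Num.Theory.

Set Implicit Arguments.
Unset Strict Implicit.
Unset Printing Implicit Defensive.

Local Open Scope classical_set_scope.

Section CotorsionCriterion.
Local Open Scope ring_scope.

Lemma divisible_chain_dvd (B : zmodType) (c : nat -> B) :
    (forall n, c n = c n.+1 *+ n.+1) ->
  forall n m, (n <= m)%N -> exists k, c n = c m *+ k.
Proof.
move=> cS n m /subnKC <-; elim: (m - n)%N => [|d [k cn]].
  by exists 1%N; rewrite addn0 mulr1n.
by exists ((n + d).+1 * k)%N; rewrite addnS mulrnA -cS.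
Qed.

(** When [c n = c n.+1 *+ n.+1], the cyclic groups generated by the [c n] increase with [n], so this
    union of them is a subgroup. *)
Definition chain_multiples (B : zmodType) (c : nat -> B) : {pred B} :=
  [pred b | `[< exists n (k : int), b = c n *~ k >]].

Lemma chain_multiples_zmod_closed (B : zmodType) (c : nat -> B) :
    (forall n, c n = c n.+1 *+ n.+1) -> zmod_closed (chain_multiples c).
Proof.
move=> cS; split; first by apply/asboolP; exists 0%N, 0; rewrite mulr0z.
move=> _ _ /asboolP[n [k ->]] /asboolP[m [l ->]]; apply/asboolP.
have [u ->] := divisible_chain_dvd cS (leq_maxl n m).
have [v ->] := divisible_chain_dvd cS (leq_maxr n m).
exists (maxn n m), (u%:Z * k - v%:Z * l).
by rewrite mulrzBr !mulrzA.
Qed.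

(** The hypotheses force [q (c n)] to be 1/n!. Hence [q] maps [chain_multiples c] bijectively onto
    the rationals, which makes it a complement of the kernel [S]. *)
Lemma direct_summand_of_chain (B : zmodType) (S : zmodClosed B)
    (q : B -> rat) (c : nat -> B) :
    (forall x y, q (x - y) = q x - q y) -> (forall b, (b \in S) = (q b == 0)) ->
    (forall n, c n = c n.+1 *+ n.+1) -> q (c 0%N) = 1 ->
  direct_summand S.
Proof.
move=> qB kerq cS qc0.
have q0 : q 0 = 0 by rewrite -(subrr 0) qB subrr.
pose qM := GRing.isZmodMorphism.Build B rat q qB.
pose Q : {additive B -> rat} := HB.pack q qM.
have qMz b (k : int) : q (b *~ k) = q b *~ k by exact: (raddfMz Q).
have qc n : q (c n) = (n`!)%:R^-1.
  elim: n => [|n IHn]; first by rewrite qc0 invr1.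
  have n1 : n.+1%:R != 0 :> rat by rewrite pnatr_eq0.
  apply: (mulIf n1); rewrite mulr_natr -(raddfMn Q) /= -cS IHn.
  by rewrite factS natrM invfM mulrAC mulVf ?mul1r.
have qc_neq0 n : q (c n) != 0.
  by rewrite qc invr_eq0 pnatr_eq0 -lt0n fact_gt0.
pose CM := GRing.isZmodClosed.Build B (chain_multiples c)
  (chain_multiples_zmod_closed cS).
pose C : zmodClosed B := HB.pack (chain_multiples c) CM.
exists C; split=> [b + /asboolP[n [k bE]]|b].
  rewrite kerq {}bE qMz -mulrzr mulf_eq0 (negPf (qc_neq0 n)) /=.
  by rewrite intr_eq0 => /eqP ->; rewrite mulr0z.
(* The denominator [d.+1] of [q b] divides (d+1)!, so [q b] is the multiple [k] of 1/(d+1)!. *)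
have [d dE] := denqP (q b).
pose k := numq (q b) * (d`!)%:Z.
have qk : q (c d.+1 *~ k) = q b.
  have kE : k%:~R = q b * (d.+1)`!%:R.
    by rewrite /k intrM numqE dE -mulrA -intrM -PoszM -factS.
  rewrite qMz qc -mulrzr kE mulrCA mulVf ?mulr1 //.
  by rewrite pnatr_eq0 -lt0n fact_gt0.
exists (b - c d.+1 *~ k), (c d.+1 *~ k); split.
- by rewrite kerq qB qk subrr.
- by apply/asboolP; exists d.+1, k.
- by rewrite subrK.
Qed.

Lemma cotorsion_of_solvable (A : zmodType) :
    (forall a : nat -> A, exists x, forall n, x n = a n + x n.+1 *+ n.+1) ->
  cotorsion A.
Proof.
move=> solvA B i S inji SE [f bijf].
pose q (b : B) : rat := f (\pi_(Quotient.quot S) b)%qT.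
have qB x y : q (x - y) = q x - q y by rewrite /q raddfB raddfB.
have kerq b : (b \in S) = (q b == 0).
  rewrite -[b in LHS]subr0 Quotient.idealrBE /q -(inj_eq (bij_inj bijf)).
  by rewrite !raddf0.
have surjq r : exists b, q b = r.
  case: bijf => g _ fK; exists (repr (g r)).
  by rewrite /q reprK fK.
have lift_inv n : exists b, q b = (n`!)%:R^-1 by exact: surjq.
have [b qb] := choice lift_inv.
(* The difference lies in the kernel of [q] because 1/n! = (n+1)/(n+1)!. *)
have bS n : exists a, b n - b n.+1 *+ n.+1 = i a.
  apply/SE; rewrite kerq qB.
  have -> : q (b n.+1 *+ n.+1) = q (b n.+1) *+ n.+1 by rewrite /q !raddfMn.
  rewrite !qb factS natrM invfM -mulrnAl -[X in X * _]mulr_natr mulVf.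
    by rewrite mul1r subrr.
  by rewrite pnatr_eq0.
have [a aE] := choice bS.
have [x xE] := solvA a.
apply: (direct_summand_of_chain (S := S) (q := q) (c := fun n => b n - i (x n))) => //.
- move=> n; rewrite {1}xE raddfD /= -aE (raddfMn i) mulrnBl opprD addrA.
  by rewrite subKr.
- have /eqP qix : q (i (x 0%N)) == 0 by rewrite -kerq; apply/SE; exists (x 0%N).
  by rewrite qB qb qix subr0 invr1.
Qed.

End CotorsionCriterion.

Section Groups.
Local Open Scope group_scope.

Lemma morphism1 (H K : groupType) (f : H -> K) :
  {morph f : x y / x * y} -> f 1 = 1.
Proof. by move=> fM; apply: (mulgI (f 1)); rewrite -fM !mulg1. Qed.

Lemma morphismX (H K : groupType) (f : H -> K) :
  {morph f : x y / x * y} -> forall n, {morph f : x / x ^+ n}.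
Proof.
move=> fM n x; elim: n => [|n IHn]; first exact: morphism1.
by rewrite !expgS fM IHn.
Qed.

Lemma additive_groupMn (A : groupType) (abelA : forall x y : A, x * y = y * x)
  (x : additive_group abelA) n : (x *+ n)%R = (x : A) ^+ n.
Proof. by elim: n => // n IHn; rewrite mulrS expgS IHn. Qed.

Lemma bond_lim_proj (G : tower) n (x : limit_group G) :
  bond G n (lim_proj n.+1 x) = lim_proj n x.
Proof. by have /asboolP := valP x; apply. Qed.

Lemma lim_proj_eq1 (G : tower) k n (x : limit_group G) :
  k <= n -> lim_proj n x = 1 -> lim_proj k x = 1.
Proof.
move=> /subnK; move: (n - k)%N => d; elim: d k => [|d IHd] k; first by move=> <-.
rewrite addSnnS => knd x1; rewrite -bond_lim_proj (IHd _ knd x1).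
exact: (morphism1 (@gmulfM _ _ (bond G k))).
Qed.

Section LimitEquations.
Variables (G : tower) (h : nat -> limit_group G).

(** The infinite iteration cut off after [d] levels: it involves only [h n], ...,
    [h (n + d - 1)]. *)
Fixpoint nested (d n : nat) : limit_group G :=
  if d is d'.+1 then h n * nested d' n.+1 ^+ n.+1 else 1.

Hypothesis h_ker : forall n, lim_proj n (h n) = 1.

Lemma lim_proj_nestedS k n :
  lim_proj k (nested (k - n) n) =
  lim_proj k (h n) * lim_proj k (nested (k - n.+1) n.+1) ^+ n.+1.
Proof.
have [kn|nk] := leqP k n.
  (* For [k <= n] both truncated differences are 0, and [h n] is already trivial in coordinate
     [k]. *)
  have -> : (k - n.+1 = 0)%N by apply/eqP; rewrite subn_eq0 leqW.
  rewrite (lim_proj_eq1 kn (h_ker n)); move: kn; rewrite -subn_eq0 => /eqP -> /=.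
  by rewrite (morphism1 (@lim_proj_mul G k)) expg1n mul1g.
by rewrite -(subnSK nk) /= lim_proj_mul (morphismX (@lim_proj_mul G k)).
Qed.

(** Levels beyond depth [k - n] only bring in [h m] with [m >= k], which coordinate [k] does not
    see. *)
Lemma lim_proj_nested k d n :
  k <= n + d -> lim_proj k (nested d n) = lim_proj k (nested (k - n) n).
Proof.
elim: d n => [|d IHd] n; first by rewrite addn0 -subn_eq0 => /eqP ->.
rewrite addnS -addSn => /IHd knd; rewrite lim_proj_nestedS -knd /=.
by rewrite lim_proj_mul (morphismX (@lim_proj_mul G k)).
Qed.

Lemma limit_equations_solvable :
  exists x : nat -> limit_group G, forall n, x n = h n * x n.+1 ^+ n.+1.
Proof.
(* The depth grows with the coordinate [k]. Compatibility holds because coordinate [k] is the same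
   at depth [k.+1 - n] as at depth [k - n]. *)
pose y n k := lim_proj k (nested (k - n) n).
have y_compat n : y n \in compatible (G := G).
  apply/asboolP => k; rewrite /y bond_lim_proj lim_proj_nested //.
  by rewrite -leq_subLR leq_sub2r.
exists (fun n => exist _ (y n) (y_compat n)) => n; apply: val_inj.
apply: functional_extensionality_dep => k.
rewrite -[RHS]/(lim_proj k _) lim_proj_mul (morphismX (@lim_proj_mul G k)).
exact: lim_proj_nestedS.
Qed.

End LimitEquations.

Lemma lift_to_kernel (G : tower) (F : normalClosed (limit_group G)) n
    (surjFn : [set lim_proj n x | x in [set` F]] = range (@lim_proj G n))
    (a : quotg F) :
  exists h, lim_proj n h = 1 /\ \pi_(quotg F)%qT h = a.
Proof.
pose g : limit_group G := repr a.
have : range (@lim_proj G n) (lim_proj n g) by exists g.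
(* Dividing the lift [g] by an element [u] of [F] with the same projection kills the projection and
   keeps the class modulo [F]. *)
rewrite -surjFn => -[u uF ug]; exists (u^-1 * g); split.
  apply: (mulgI (lim_proj n u)).
  by rewrite -lim_proj_mul mulVKg mulg1.
rewrite -[RHS]reprK; apply/eqP; rewrite -eqv_modE.
by rewrite mulgK gpredV.
Qed.

End Groups.

Theorem theorem0p0p4 (G : tower) (F : normalClosed (limit_group G))
    (abelF : forall x y : quotg F, (x * y = y * x)%g)
    (surjF : forall n : nat,
       [set lim_proj n x | x in [set` F]] = range (@lim_proj G n)) :
  cotorsion (additive_group abelF).
Proof.
apply: cotorsion_of_solvable => a.
have [h hP] := choice (fun n => lift_to_kernel (surjF n) (a n)).
have [x xE] := limit_equations_solvable (fun n => (hP n).1).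
exists (fun n => \pi_(quotg F)%qT (x n)) => n.
rewrite {1}xE additive_groupMn -(hP n).2.
have piM : {morph \pi_(quotg F)%qT : u v / (u * v)%g} := gmulfM.
by rewrite piM (morphismX piM).
Qed.
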